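(* Let $P^{\mathrm{obs}}$ be a Borel probability law of $(Y,X)$ with $Y\in\mathbb R^T$, $X=(X_1,\dots,X_T)$, $X_t\in\mathbb R^k$. For $b\in\mathcal B$ and $R_t(b)=Y_t-X_t'b$, define $$\ell_t(x,b)=\operatorname{ess\,inf}\{R_t(b)\mid X=x\},\qquad u_t(x,b)=\operatorname{ess\,sup}\{R_t(b)\mid X=x\}.$$ If $b\in\Theta_I$, then for $P_X$-almost every $x$, $$\bigcap_{t=1}^T[\ell_t(x,b),u_t(x,b)]\ne\varnothing .$$
   Context: $T,k\ge1$ are fixed integers, $\tau\in(0,1)$, $\mathcal B\subseteq\mathbb R^k$. $\Theta_I$ is the set of $b\in\mathcal B$ for which there exists a Borel probability law $P^{\mathrm s}$ of $(Y,X,A,U)$, $A\in\mathbb R$, $U\in\mathbb R^T$, with $(Y,X)$-marginal $P^{\mathrm{obs}}$, with $Y_t=X_t'b+A+U_t$ a.s. for all $t$, and with $P^{\mathrm s}(U_t\le0\mid X,A)\ge\tau$, $P^{\mathrm s}(U_t<0\mid X,A)\le\tau$ a.s. for all $t$. $P_X$ is the marginal law of $X$; the essential infimum and supremum are those of the conditional law of $R_t(b)$ given $X=x$ under $P^{\mathrm{obs}}$. They may be infinite, and $[\ell,u]$ denotes $\{a\in\mathbb R:\ell\le a\le u\}$. *)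

(* Defs.v *)
From HB Require Import structures.
From mathcomp Require Import all_boot all_order all_algebra.
From mathcomp Require Import all_classical all_reals all_analysis ess_sup_inf.
Set Implicit Arguments.
Unset Strict Implicit.
Unset Printing Implicit Defensive.
Import Order.TTheory GRing.Theory Num.Theory.
Import numFieldNormedType.Exports.
Local Open Scope classical_set_scope.
Local Open Scope ring_scope.

(* Vectors are tuples: the library equips n.-tuple R with the product of the
   Borel sigma-algebras, which is the Borel sigma-algebra of R^n. *)
Notation outcomes R T := (T.-tuple R).
Notation regressors R T k := (T.-tuple (k.-tuple R)).

Section conditioning.
Context d d' (R : realType) (Omega : measurableType d) (S : measurableType d')
  (P : probability Omega R) (Z : Omega -> S).

(* g is a version of z |-> P(E | Z = z); the random variable P(E | Z) is
   then g \o Z, up to a P-null set. *)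
Definition is_cond_prob (E : set Omega) (g : S -> R) : Prop :=
  [/\ measurable_fun [set: S] g,
      P.-integrable [set: Omega] (fun w => (g (Z w))%:E) &
      forall B : set S, measurable B ->
        (\int[P]_(w in Z @^-1` B) (g (Z w))%:E = P (E `&` Z @^-1` B))%E].

(* kappa is a version of the conditional law of V given Z. *)
Definition is_cond_law (V : Omega -> R) (kappa : R.-pker S ~> R) : Prop :=
  forall (B : set S) (C : set R), measurable B -> measurable C ->
    (\int[P]_(w in Z @^-1` B) kappa (Z w) C
     = P (Z @^-1` B `&` V @^-1` C))%E.

End conditioning.

Section model.
Context (R : realType) (T k : nat).
Local Notation obs := (outcomes R T * regressors R T k)%type.
Local Notation full :=
  (outcomes R T * regressors R T k * R * outcomes R T)%type.

Definition dotp (x b : k.-tuple R) : R := \sum_(j < k) tnth x j * tnth b j.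

Definition obsX (w : obs) : regressors R T k := w.2.

Definition residual (b : k.-tuple R) (t : 'I_T) (w : obs) : R :=
  tnth w.1 t - dotp (tnth (obsX w) t) b.

HB.instance Definition _ := isMeasurableFun.Build _ _ _ _ obsX
  (@measurable_snd _ _ (outcomes R T) (regressors R T k)).

Definition lawX (Pobs : probability obs R) : probability (regressors R T k) R :=
  distribution Pobs obsX.

Definition coordY (w : full) : outcomes R T := w.1.1.1.
Definition coordX (w : full) : regressors R T k := w.1.1.2.
Definition coordA (w : full) : R := w.1.2.
Definition coordU (w : full) : outcomes R T := w.2.

(* The conditional probabilities are required to have some version satisfying
   the bound almost surely; as versions agree almost surely, this is the same
   as requiring it of all versions. *)
Definition rationalizes (tau : R) (Pobs : probability obs R)
    (b : k.-tuple R) (Ps : probability full R) : Prop :=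
  [/\ forall D : set obs, measurable D ->
        Ps [set w | D (coordY w, coordX w)] = Pobs D,
      forall t : 'I_T, {ae Ps, forall w,
        tnth (coordY w) t
        = dotp (tnth (coordX w) t) b + coordA w + tnth (coordU w) t},
      forall t : 'I_T, exists2 g : regressors R T k * R -> R,
        is_cond_prob Ps (fun w => (coordX w, coordA w))
          [set w | tnth (coordU w) t <= 0] g &
        {ae Ps, forall w, tau <= g (coordX w, coordA w)} &
      forall t : 'I_T, exists2 g : regressors R T k * R -> R,
        is_cond_prob Ps (fun w => (coordX w, coordA w))
          [set w | tnth (coordU w) t < 0] g &
        {ae Ps, forall w, g (coordX w, coordA w) <= tau}].

Definition ThetaI (tau : R) (B : set (k.-tuple R)) (Pobs : probability obs R) :
    set (k.-tuple R) :=
  [set b | B b /\ exists Ps : probability full R, rationalizes tau Pobs b Ps].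

End model.

Section essential_bounds.
Context (R : realType).

Definition law_ess_inf (mu : {measure set R -> \bar R}) : \bar R :=
  ess_inf mu (fun r => r%:E).

Definition law_ess_sup (mu : {measure set R -> \bar R}) : \bar R :=
  ess_sup mu (fun r => r%:E).

Definition real_itv (l u : \bar R) : set R :=
  [set a | (l <= a%:E)%E /\ (a%:E <= u)%E].

End essential_bounds.

(* Main.v *)
(* If the intervals [l_t(x), u_t(x)] had no common point, then, by Helly's
   theorem on the line, u_s(x) < q < l_t(x) for some s, t and some rational q. On the
   measurable set of such x one has R_s < q < R_t almost surely. There A <= q
   forces U_t > 0, which contradicts P(U_t <= 0 | X, A) >= tau > 0, and A >= q
   forces U_s < 0, which contradicts P(U_s < 0 | X, A) <= tau < 1. Hence each of
   these countably many sets of x is null. *)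
Require Import Defs.
From mathcomp Require Import all_boot all_order all_algebra.
From mathcomp Require Import all_classical all_reals all_analysis.
From mathcomp Require Import ess_sup_inf measurable_realfun ring lra.
Import Order.TTheory GRing.Theory Num.Theory.
Import numFieldNormedType.Exports.
Local Open Scope classical_set_scope.
Local Open Scope ring_scope.

(** Removing the null exceptional set [N] changes neither integral, and on [D] minus [N] the
    inequality holds pointwise. *)
Lemma ae_le_integral d (T : measurableType d) (R : realType)
    (mu : {measure set T -> \bar R}) (D : set T) (f g : T -> \bar R) :
  measurable D -> mu.-integrable D f -> mu.-integrable D g ->
  {ae mu, forall x, D x -> (f x <= g x)%E} ->
  (\int[mu]_(x in D) f x <= \int[mu]_(x in D) g x)%E.
Proof.
move=> mD intf intg [N [mN muN0 fgN]].
rewrite (negligible_integral mN mD intf muN0).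
rewrite (negligible_integral mN mD intg muN0).
have mDN : measurable (D `\` N) by exact: measurableD.
apply: le_integral => //; [exact: integrableS intf|exact: integrableS intg|].
move=> x; rewrite inE => -[Dx Nx]; apply: contrapT => fg.
by apply: Nx; apply: fgN => /= /(_ Dx).
Qed.

(** * Null events from bounds on conditional probabilities *)

Section conditional_probability.
Context d d' (R : realType) (Omega : measurableType d) (S : measurableType d')
  (P : probability Omega R) (Z : Omega -> S)
  (mZ : measurable_fun [set: Omega] Z).
Implicit Types (E : set Omega) (B : set S) (g : S -> R) (c : R).

Let mpre B : measurable B -> measurable (Z @^-1` B).
Proof. by move=> mB; rewrite -[_ @^-1` _]setTI; exact: mZ. Qed.

(** Integrating [c <= g (Z w)] over the event that [Z] lies in [B] bounds [c] times its probability
    by the probability of its intersection with [E], which is zero. *)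
Lemma cond_prob_ge_null E B g c : is_cond_prob P Z E g -> 0 < c ->
    {ae P, forall w, c <= g (Z w)} -> measurable B ->
  P (E `&` Z @^-1` B) = 0%E -> P (Z @^-1` B) = 0%E.
Proof.
move=> [mg intg condg] c0 cg mB PEB.
have mZB := mpre B mB.
have : (c%:E * P (Z @^-1` B) <= 0)%E.
  rewrite -PEB -condg// -integral_cst//; apply: ae_le_integral => //.
  - exact: finite_measure_integrable_cst.
  - exact: integrableS intg.
  - by apply: filterS cg => w cgw _; rewrite lee_fin.
rewrite pmule_rle0 ?lte_fin// => PB0.
by apply/eqP; rewrite eq_le PB0 measure_ge0.
Qed.

(** Up to a null set the event that [Z] lies in [B] is contained in [E], so integrating
    [g (Z w) <= c] gives [p <= c * p] for its finite probability [p]; as [c < 1], [p] vanishes. *)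
Lemma cond_prob_le_null E B g c : measurable E -> is_cond_prob P Z E g ->
    c < 1 -> {ae P, forall w, g (Z w) <= c} -> measurable B ->
  P (~` E `&` Z @^-1` B) = 0%E -> P (Z @^-1` B) = 0%E.
Proof.
move=> mE [mg intg condg] c1 gc mB PEB.
have mZB := mpre B mB.
have PZB : P (Z @^-1` B) = P (E `&` Z @^-1` B).
  rewrite [LHS](measureDI P mZB mE) setDE setIC [X in (X + _)%E]PEB add0e.
  by rewrite setIC.
have : (P (Z @^-1` B) <= c%:E * P (Z @^-1` B))%E.
  rewrite {1}PZB -condg// -integral_cst//; apply: ae_le_integral => //.
  - exact: integrableS intg.
  - exact: finite_measure_integrable_cst.
  - by apply: filterS gc => w gcw _; rewrite lee_fin.
have /fineK <- : P (Z @^-1` B) \is a fin_num by exact: fin_num_measure.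
have : 0 <= fine (P (Z @^-1` B)) by rewrite fine_ge0.
rewrite -EFinM lee_fin => P0 Pc; congr EFin; nra.
Qed.

End conditional_probability.
Arguments cond_prob_ge_null {d d' R Omega S P Z} mZ {E B g c}.
Arguments cond_prob_le_null {d d' R Omega S P Z} mZ {E B g c}.

(** * Essential bounds and intersections of intervals *)

Section essential_bounds_facts.
Context (R : realType) (mu : {measure set R -> \bar R}).

(** Otherwise the identity would equal [+oo] almost everywhere; under a nonzero measure some real
    number would then be infinite. *)
Lemma law_ess_inf_lty : (0 < mu [set: R])%E -> (law_ess_inf mu < +oo)%E.
Proof.
move=> mu0; rewrite ltey; apply/negP => /eqP /ess_inf_eqyP.
have ? : ProperFilter (almost_everywhere mu).
  exact: ae_properfilter_algebraOfSetsType.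
by move=> /filter_ex[].
Qed.

Lemma law_ess_sup_gtNy : (0 < mu [set: R])%E -> (-oo < law_ess_sup mu)%E.
Proof.
move=> mu0; rewrite ltNye; apply/negP => /eqP /ess_sup_eqNyP.
have ? : ProperFilter (almost_everywhere mu).
  exact: ae_properfilter_algebraOfSetsType.
by move=> /filter_ex[].
Qed.

Lemma lt_law_ess_inf_null (q : R) : (q%:E < law_ess_inf mu)%E ->
  mu `]-oo, q]%classic = 0%E.
Proof.
move=> q_lt; apply/negligibleP => //.
apply: negligibleS (ess_inf_le mu (fun r => r%:E)) => r /=.
rewrite in_itv/= => rq; apply/negP; rewrite -ltNge.
by apply: le_lt_trans q_lt; rewrite lee_fin.
Qed.

Lemma gt_law_ess_sup_null (q : R) : (law_ess_sup mu < q%:E)%E ->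
  mu `[q, +oo[%classic = 0%E.
Proof.
move=> q_gt; apply/negligibleP => //.
apply: negligibleS (ess_sup_ge mu (fun r => r%:E)) => r /=.
rewrite in_itv/= andbT => qr; apply/negP; rewrite -ltNge.
by apply: lt_le_trans q_gt _; rewrite lee_fin.
Qed.

End essential_bounds_facts.

Lemma lte_rat_between (R : realType) (x y : \bar R) : (x < y)%E ->
  exists q : rat, (x < (ratr q)%:E)%E /\ ((ratr q)%:E < y)%E.
Proof.
have dense (a b : R) : a < b ->
    exists q : rat, (a%:E < (ratr q)%:E)%E /\ ((ratr q)%:E < b%:E)%E.
  move=> /rat_in_itvoo[q]; rewrite in_itv/= => /andP[aq qb].
  by exists q; rewrite !lte_fin.
case: x y => [a| |] [b| |]//.
- by rewrite lte_fin; exact: dense.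
(* An infinite endpoint is replaced by a real one at distance 1 from the other. *)
- move=> _; have [|q [aq _]] := dense a (a + 1); first by rewrite ltrDl.
  by exists q; rewrite aq ltry.
- move=> _; have [|q [_ qb]] := dense (b - 1) b; first by rewrite ltrBlDr ltrDl.
  by exists q; rewrite ltNyr qb.
- by move=> _; exists 0; rewrite ltNyr ltry.
Qed.

(** The intersection is cut out by the largest [l i] and the smallest [u i]. The two strict bounds
    exclude [[+oo, +oo]] and [[-oo, -oo]], which contain no real point. *)
Lemma bigcap_real_itv_nonempty (R : realType) (I : finType)
    (l u : I -> \bar R) :
    (forall i, l i < +oo)%E -> (forall i, -oo < u i)%E ->
    (forall i j, l i <= u j)%E ->
  \bigcap_(i in [set: I]) real_itv (l i) (u i) !=set0.
Proof.
move=> ly uNy lu.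
have [i0 _|I0] := pickP (@predT I); last first.
  by exists 0 => i _; have := I0 i.
have [i1 _ li1] : exists2 i, true & forall j, (l j <= l i)%E.
  case: (@Order.TotalTheory.arg_maxP _ _ _ i0 xpredT l) => // i _ li.
  by exists i => // j; exact: li.
have [i2 _ ui2] : exists2 i, true & forall j, (u i <= u j)%E.
  case: (@Order.TotalTheory.arg_minP _ _ _ i0 xpredT u) => // i _ ui.
  by exists i => // j; exact: ui.
suff [a la au] : exists2 a : R, (l i1 <= a%:E)%E & (a%:E <= u i2)%E.
  exists a => i _; split; [exact: le_trans la|exact: le_trans (ui2 i)].
move: (ly i1) (uNy i2) (lu i1 i2).
(* A finite endpoint serves as the common point, or 0 if both are infinite. *)
case: (l i1) (u i2) => [r| |] [s| |]// _ _ rs.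
- by exists r.
- by exists r; rewrite ?leey.
- by exists s; rewrite ?leNye.
- by exists 0; rewrite ?leNye ?leey.
Qed.

(** Reduces to sequences through [pickle]; integers coding no index carry the condition [True]. *)
Lemma ae_forall_countable d (T : measurableType d) (R : realType)
    (mu : {measure set T -> \bar R}) (I : countType) (Q : I -> T -> Prop) :
  (forall i, {ae mu, forall x, Q i x}) -> {ae mu, forall x, forall i, Q i x}.
Proof.
move=> aeQ.
have : {ae mu, forall x, forall n,
    if unpickle n is Some i then Q i x else True}.
  apply: ae_foralln => n; case: unpickle => [i|]; first exact: aeQ.
  exact: filterT.
by apply: filterS => x Qx i; have := Qx (pickle i); rewrite pickleK.
Qed.

(** * Separated residuals under a rationalizing law *)

Section model_facts.
Context (R : realType) (T k : nat).
Local Notation obs := (outcomes R T * regressors R T k)%type.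
Local Notation full :=
  (outcomes R T * regressors R T k * R * outcomes R T)%type.

Lemma measurable_coordY : measurable_fun [set: full] (@coordY R T k).
Proof.
apply: (measurableT_comp measurable_fst).
apply: (measurableT_comp measurable_fst); exact: measurable_fst.
Qed.

Lemma measurable_coordX : measurable_fun [set: full] (@coordX R T k).
Proof.
apply: (measurableT_comp measurable_snd).
apply: (measurableT_comp measurable_fst); exact: measurable_fst.
Qed.

Lemma measurable_coordA : measurable_fun [set: full] (@coordA R T k).
Proof. apply: (measurableT_comp measurable_snd); exact: measurable_fst. Qed.

Lemma measurable_coordU : measurable_fun [set: full] (@coordU R T k).
Proof. exact: measurable_snd. Qed.

Lemma measurable_residual (b : k.-tuple R) (t : 'I_T) :
  measurable_fun [set: obs] (residual b t).
Proof.
apply: measurable_funB.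
  apply: (measurableT_comp (measurable_tnth t)); exact: measurable_fst.
apply: measurable_sum => j; apply: measurable_funM => //.
apply: (measurableT_comp (measurable_tnth j)).
apply: (measurableT_comp (measurable_tnth t)); exact: measurable_snd.
Qed.

Lemma rationalizes_null (tau : R) (Pobs : probability obs R) (b : k.-tuple R)
    (Ps : probability full R) (t s : 'I_T) (q : R)
    (B : set (regressors R T k)) :
    0 < tau -> tau < 1 -> rationalizes tau Pobs b Ps -> measurable B ->
    Pobs (@obsX R T k @^-1` B `&` residual b t @^-1` `]-oo, q]%classic) = 0%E ->
    Pobs (@obsX R T k @^-1` B `&` residual b s @^-1` `[q, +oo[%classic) = 0%E ->
  lawX Pobs B = 0%E.
Proof.
move=> tau0 tau1 [margPs eqPs lePs ltPs] mB Rt Rs.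
pose Z (w : full) := (coordX w, coordA w).
have mZ : measurable_fun [set: full] Z.
  exact: measurable_fun_pair measurable_coordX measurable_coordA.
have mres (r : 'I_T) (C : set R) : measurable C ->
    measurable (@obsX R T k @^-1` B `&` residual b r @^-1` C).
  move=> mC; apply: measurableI.
    by rewrite -[_ @^-1` _]setTI; exact: measurable_snd.
  by rewrite -[_ @^-1` _]setTI; exact: measurable_residual.
have mUr (r : 'I_T) (C : set R) : measurable C ->
    measurable [set w : full | C (tnth (coordU w) r)].
  move=> mC; rewrite -[X in measurable X]setTI.
  by apply: (measurableT_comp (measurable_tnth r) measurable_coordU).
have mBC (C : set R) : measurable C -> measurable (Z @^-1` (B `*` C)).
  by move=> mC; rewrite -[_ @^-1` _]setTI; apply: mZ => //; exact: measurableX.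
(* Transfers null events from [Pobs] to [Ps]: the marginals agree, and the residual equals [A + U_r]
   outside the null set where the model equation fails. *)
have null_resid (r : 'I_T) (C : set R) (F : set full) : measurable C ->
    measurable F ->
    Pobs (@obsX R T k @^-1` B `&` residual b r @^-1` C) = 0%E ->
    (forall w, F w -> B (coordX w) /\ C (coordA w + tnth (coordU w) r)) ->
    Ps F = 0%E.
  move=> mC mF PC FC; apply: measure_negligible => //.
  have nC : Ps.-negligible [set w | (@obsX R T k @^-1` B `&`
      residual b r @^-1` C) (coordY w, coordX w)].
    apply/negligibleP; last exact: etrans (margPs _ (mres r C mC)) PC.
    rewrite -[X in measurable X]setTI.
    apply: (measurable_fun_pair measurable_coordY measurable_coordX) => //.
    exact: mres.
  apply: negligibleS (negligibleU nC (eqPs r)) => w /FC[Bw Cw].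
  have [eqw|neqw] := eqVneq (tnth (coordY w) r)
    (dotp (tnth (coordX w) r) b + coordA w + tnth (coordU w) r).
    left; split => //=; rewrite /residual /= eqw.
    by rewrite [X in C X](_ : _ = coordA w + tnth (coordU w) r)//; ring.
  by right => /=; apply/eqP.
(* If [A <= q] and [U_t <= 0], then [A + U_t <= q], a null event on [B] by [Rt]. *)
have A_le : Ps (Z @^-1` (B `*` `]-oo, q]%classic)) = 0%E.
  have [g condg taug] := lePs t.
  apply: (cond_prob_ge_null mZ condg tau0 taug).
    exact: measurableX.
  apply: (null_resid t _ _ _ _ Rt) => //.
    apply: measurableI; [apply: (mUr t [set u | u <= 0])|exact: mBC].
    by rewrite -set_itvNyc.
  move=> w [/= Uw [/= Bw]]; rewrite !in_itv/= => Aq.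
  by split=> //; lra.
(* Symmetrically, [A >= q] and [U_s >= 0] give [A + U_s >= q], null by [Rs]. *)
have A_ge : Ps (Z @^-1` (B `*` `[q, +oo[%classic)) = 0%E.
  have mU_lt : measurable [set w : full | tnth (coordU w) s < 0].
    by apply: (mUr s [set u | u < 0]); rewrite -set_itvNyo.
  have [g condg gtau] := ltPs s.
  apply: (cond_prob_le_null mZ _ condg tau1 gtau).
  - exact: mU_lt.
  - exact: measurableX.
  apply: (null_resid s _ _ _ _ Rs) => //.
    apply: measurableI; last exact: mBC.
    by rewrite -setTD; exact: measurableD.
  move=> w [/= Uw [/= Bw]]; rewrite !in_itv/= !andbT => Aq.
  have : 0 <= tnth (coordU w) s by rewrite leNgt; apply/negP.
  by split=> //; lra.
have mXB : measurable (@obsX R T k @^-1` B).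
  by rewrite -[_ @^-1` _]setTI; exact: measurable_snd.
apply: etrans (esym (margPs _ mXB)) _.
rewrite [X in Ps X](_ : _ = Z @^-1` (B `*` `]-oo, q]%classic) `|`
    Z @^-1` (B `*` `[q, +oo[%classic)).
  by rewrite null_set_setU//; exact: mBC.
apply/seteqP; split => w /=; last by case=> -[].
move=> Bw; have [Aq|/ltW qA] := leP (coordA w) q.
  by left; split => //=; rewrite in_itv.
by right; split => //=; rewrite in_itv/= andbT.
Qed.

End model_facts.
Arguments rationalizes_null {R T k tau Pobs b Ps} t s q {B}.

Theorem lemma3p5 (R : realType) (T k : nat) (hT : (1 <= T)%N) (hk : (1 <= k)%N)
    (tau : R) (htau0 : 0 < tau) (htau1 : tau < 1) (B : set (k.-tuple R))
    (Pobs : probability (outcomes R T * regressors R T k)%type R)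
    (b : k.-tuple R)
    (kappa : 'I_T -> R.-pker (regressors R T k) ~> R)
    (hkappa : forall t : 'I_T,
       is_cond_law Pobs (@obsX R T k) (residual b t) (kappa t)) :
  ThetaI tau B Pobs b ->
  {ae lawX Pobs, forall x : regressors R T k,
    \bigcap_(t in [set: 'I_T])
      real_itv (law_ess_inf (kappa t x)) (law_ess_sup (kappa t x)) !=set0}.
Proof.
move=> [_ [Ps ratPs]].
have sep_null (t s : 'I_T) (q : rat) :
    {ae lawX Pobs, forall x, ~ (kappa t x `]-oo, ratr q]%classic = 0%E /\
      kappa s x `[ratr q, +oo[%classic = 0%E)}.
  (* Stating separation through null half-lines makes [N] measurable directly from the kernel
     property. Integrating the vanishing kernels over [N] yields the two null hypotheses on the
     residuals. *)
  pose N := [set x | kappa t x `]-oo, ratr q]%classic = 0%E] `&`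
    [set x | kappa s x `[ratr q, +oo[%classic = 0%E].
  have mker (r : 'I_T) (C : set R) : measurable C ->
      measurable [set x | kappa r x C = 0%E].
    move=> mC; rewrite -[X in measurable X]setTI.
    exact: (measurable_kernel (kappa r) C mC measurableT [set 0%E]).
  have mN : measurable N by apply: measurableI; exact: mker.
  have PN : lawX Pobs N = 0%E.
    apply: (rationalizes_null t s (ratr q) htau0 htau1 ratPs mN).
      by rewrite -hkappa//; apply: integral0_eq => w -[].
    by rewrite -hkappa//; apply: integral0_eq => w -[].
  exists N; split => // x /= /contrapT[xt xs].
  by split.
have : {ae lawX Pobs, forall x, forall i : 'I_T * 'I_T * rat,
    ~ (kappa i.1.1 x `]-oo, ratr i.2]%classic = 0%E /\
      kappa i.1.2 x `[ratr i.2, +oo[%classic = 0%E)}.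
  by apply: ae_forall_countable => -[[t s] q]; exact: sep_null.
apply: filterS => x sep.
have kappa_gt0 t : (0 < kappa t x [set: R])%E by rewrite prob_kernel.
apply: bigcap_real_itv_nonempty => [t|t|t s].
- exact: law_ess_inf_lty.
- exact: law_ess_sup_gtNy.
(* A rational strictly between [u_s] and [l_t] would make both half-lines null, which [sep]
   forbids. *)
- rewrite leNgt; apply/negP => /lte_rat_between[q [sq qt]].
  apply: (sep (t, s, q)); split => /=.
    exact: lt_law_ess_inf_null.
  exact: gt_law_ess_sup_null.
Qed.
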